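(* Let $A\in\mathbb{R}^{m\times n}$ and $b\in\mathbb{R}^m$ be such that $Ax=b$ has a solution, and let $K=\min\{\|x\|_0:Ax=b\}$. Let $\alpha\in(0,\infty]$ and let $\psi:[0,\infty)\times(0,\alpha)\to[0,\infty)$ satisfy: (a) $\psi(\cdot,q)$ is lower semi-continuous and increasing on $[0,\infty)$ for any $q\in(0,\alpha)$; (b) $\frac{\partial^2\psi}{\partial t^2}(t,q)<0$ for all $t>0$ and $q\in(0,\alpha)$; (c) $\psi(0,q)=0$ for all $q\in(0,\alpha)$, and $\lim_{q\to0^+}\psi(t,q)=1$ for all $t>0$. Then for any integer $r$ with $0\le r\le\min\{K,n-1\}$ and all sufficiently small $q>0$, any global minimizer $x^*$ of the problem $$\min_{x\in\mathbb{R}^n}\Big\{\sum_{i=r+1}^n\psi(|x|_{[i]},q):\ Ax=b\Big\}$$ is also a global minimizer of $\min\{\|x\|_0:Ax=b\}$, that is, $x^*$ is a sparsest solution to the system $Ax=b$.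
   Context: $|x|_{[i]}$ denotes the $i$th largest element of $\{|x_1|,\ldots,|x_n|\}$ (counted with multiplicity). $\|x\|_0$ is the number of nonzero entries of $x$. ''Increasing'' is meant in the weak sense. ''For all sufficiently small $q>0$'' means: there exists $\epsilon\in(0,\alpha)$ such that the conclusion holds for every $q\in(0,\epsilon)$. *)

(* Defs.v *)
From HB Require Import structures.
From mathcomp Require Import all_boot all_order all_algebra.
From mathcomp Require Import all_classical all_reals all_analysis.

Set Implicit Arguments.
Unset Strict Implicit.
Unset Printing Implicit Defensive.

Import Order.TTheory GRing.Theory Num.Theory.
Import numFieldNormedType.Exports.

Local Open Scope classical_set_scope.
Local Open Scope ring_scope.

Definition norm0 (R : realType) (n : nat) (x : 'cV[R]_n) : nat :=
  #|[pred i : 'I_n | x i ord0 != 0]|.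

(* [abs_rank x i] is the [i]-th largest of the |x_j|, counted with multiplicity,
   for i = 1, ..., n; since [nth] is 0-based the index is shifted. *)
Definition abs_rank (R : realType) (n : nat) (x : 'cV[R]_n) (i : nat) : R :=
  nth 0 (sort >=%R [seq `|x j ord0| | j <- enum 'I_n]) i.-1.

Definition solutions (R : realType) (m n : nat) (A : 'M[R]_(m, n))
    (b : 'cV[R]_m) : set 'cV[R]_n :=
  [set x | A *m x = b].

Definition is_min d (T : porderType d) (E : set T) (k : T) : Prop :=
  E k /\ lbound E k.

Definition global_minimizer (X : Type) d (T : porderType d) (f : X -> T)
    (S : set X) (x : X) : Prop :=
  S x /\ forall y, S y -> (f x <= f y)%O.

(* A function on [0, +oo[ x ]0, alpha[ is represented by a total
   [psi : R -> R -> R] whose values off that domain are never constrained or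
   used.  Lower semi-continuity on [0, +oo[ is with respect to the relative
   topology, hence the [subspace]. *)
Definition lsc_nonneg (R : realType) (f : R -> R) : Prop :=
  lower_semicontinuous
    (fun t : subspace ([set` `[0, +oo[] : set R) => (f t)%:E).

Definition increasing_nonneg (R : realType) (f : R -> R) : Prop :=
  {in `[0, +oo[ &, {homo f : s t / s <= t}}.

(* Since [derive1n] is total, existence of the second derivative at every t > 0
   has to be required separately. *)
Definition neg_second_derivative (R : realType) (f : R -> R) : Prop :=
  forall t : R, 0 < t ->
    [/\ derivable f t 1, derivable (derive1 f) t 1 & derive1n 2 f t < 0].

Definition rank_objective (R : realType) (psi : R -> R -> R) (r : nat) (q : R)
    (n : nat) (x : 'cV[R]_n) : R :=
  \sum_(r.+1 <= i < n.+1) psi (abs_rank x i) q.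

(* Main.v *)
Require Import Defs.
From HB Require Import structures.
From mathcomp Require Import all_boot all_order all_algebra.
From mathcomp Require Import all_classical all_reals all_analysis.
From mathcomp Require Import zify ring lra.

Import Order.TTheory GRing.Theory Num.Theory.
Import numFieldNormedType.Exports.

Local Open Scope ring_scope.

(** Since [psi] is increasing in its first argument, the sum of [psi] over the
    [n - r] smallest absolute values is the minimum, over all index sets [S] of
    size [n - r], of the separable sums [\sum_(i in S) psi |x_i|]. Hence a
    minimizer [x] of the rank objective minimizes one of these separable sums,
    for a set [S] that depends on [x] ([rank_objective_le_subset],
    [rank_objective_eq_subset]).

    Strict concavity of [psi] on [t > 0] then makes [x] rigid on [S]: a kernel
    vector [v] of [A] that vanishes wherever [x] does on [S] must vanish on all
    of [S], for otherwise [x + h v] and [x - h v] would be feasible with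
    unchanged signs on [S] and one of them would be strictly better
    ([subset_minimizer_rigid]). The difference of two rigid solutions with the
    same [S] and the same support in [S] is such a kernel vector, so a rigid
    solution is determined on [S] by this finite data. The nonzero entries on
    [S] of all rigid solutions are therefore bounded below by one constant
    [c > 0], which depends on [A] and [b] but not on [q]
    ([rigid_entries_bounded_below]).

    Let [xs] be a sparsest solution and [M] a bound for its entries. A minimizer
    with more than [K] nonzero entries has at least [K + 1 - r] of them in [S],
    so its objective is at least [(K + 1 - r) psi(c, q)]
    ([subset_objective_ge]), while that of [xs] is at most [(K - r) psi(M, q)]
    ([rank_objective_le]). As [q] tends to [0] both values of [psi] tend to [1],
    and the two bounds contradict each other for all small [q]. *)

(** * Finite sets *)

Lemma finite_uniform_pos (R : realType) (I : finType) (P : I -> R -> Prop) :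
  (forall i c d, d <= c -> P i c -> P i d) ->
  (forall i, exists2 c, 0 < c & P i c) ->
  exists2 c, 0 < c & forall i, P i c.
Proof.
move=> P_down P_pos.
have /choice [c cP] : forall i, exists c, 0 < c /\ P i c.
  by move=> i; have [c] := P_pos i; exists c.
exists (\big[Num.min/1]_i c i).
  by apply: lt_bigmin => // i _; case: (cP i).
by move=> i; apply: P_down (bigmin_le _ i _) _; case: (cP i).
Qed.

Lemma exists_subset_card (T : finType) (B : {set T}) (k : nat) :
  (k <= #|B|)%N -> exists2 S : {set T}, S \subset B & #|S| = k.
Proof.
move=> kB; exists [set i in take k (enum B)].
  by apply/fintype.subsetP => i; rewrite inE => /mem_take; rewrite mem_enum.
rewrite cardsE; have /card_uniqP -> := take_uniq k (enum_uniq B).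
by rewrite size_take -cardE; case: ltnP => // Bk; apply: anti_leq; rewrite kB Bk.
Qed.

(** * Strict concavity *)

Lemma derivable_pos_MVT (R : realType) (f : R -> R) (a b : R) :
  (forall t, 0 < t -> derivable f t 1) -> 0 < a -> a < b ->
  exists2 c, a < c < b & f b - f a = derive1 f c * (b - a).
Proof.
move=> df a0 ab.
have [||c] := @MVT R f (derive1 f) a b ab; last 1 first.
- by rewrite in_itv /=; exists c.
- move=> x; rewrite in_itv /= => /andP[ax _]; rewrite derive1E.
  by apply/derivableP/df/(lt_trans a0).
- apply: derivable_within_continuous => x; rewrite in_itv /= => /andP[ax _].
  by apply/df/(lt_le_trans a0).
Qed.

(** The mean slopes of [f] on both sides of [t] are values of the derivative of
    [f], which is strictly decreasing. *)
Lemma neg_second_derivative_midpoint (R : realType) (f : R -> R) (t d : R) :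
  neg_second_derivative f -> 0 < d -> d < t ->
  f (t + d) + f (t - d) < f t + f t.
Proof.
move=> f2 d0 dt.
have df x : 0 < x -> derivable f x 1 by move=> /f2[].
have ddf x : 0 < x -> derivable (derive1 f) x 1 by move=> /f2[].
have [||c1 /andP[h1 h2] e1] := @derivable_pos_MVT R f (t - d) t df; [lra..|].
have [||c2 /andP[h3 h4] e2] := @derivable_pos_MVT R f t (t + d) df; [lra..|].
have [||c3 /andP[h5 h6] e3] := @derivable_pos_MVT R _ c1 c2 ddf; [lra..|].
have neg : derive1 (derive1 f) c3 < 0.
  by have [|_ _] := f2 c3; first lra.
have : derive1 (derive1 f) c3 * (c2 - c1) < 0.
  by rewrite nmulr_rlt0 // subr_gt0; lra.
rewrite -e3 => lt12.
have e2' : f (t + d) - f t = derive1 f c2 * d.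
  by rewrite e2; congr (_ * _); ring.
have e1' : f t - f (t - d) = derive1 f c1 * d.
  by rewrite e1; congr (_ * _); ring.
have : (derive1 f c2 - derive1 f c1) * d < 0 by rewrite pmulr_llt0.
by rewrite mulrBl -e1' -e2'; lra.
Qed.

(** * The rank objective as a minimum of separable objectives *)

(** The ranking enters the proof only through this lemma. The set [D] holds the
    indices ranked after the first [r] by decreasing absolute value, and [c] is
    the [(r + 1)]-th largest absolute value, which separates [D] from its
    complement. *)
Lemma smallest_ranks (R : realType) (n r : nat) (x : 'cV[R]_n) : (r < n)%N ->
  exists (D : {set 'I_n}) (c : R),
    [/\ #|D| = (n - r)%N, 0 <= c, (forall i, i \in D -> `|x i ord0| <= c),
        (forall i, i \notin D -> c <= `|x i ord0|) &
        forall f : R -> R, \sum_(r.+1 <= i < n.+1) f (abs_rank x i)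
                           = \sum_(i in D) f `|x i ord0| ].
Proof.
move=> rn; pose a i := `|x i ord0|; pose i0 := Ordinal rn.
(* Sorting the indices instead of the values turns positions in the sorted list
   into a set of indices even when absolute values are repeated. *)
pose p := sort (relpre a >=%R) (enum 'I_n).
have szp : size p = n by rewrite size_sort size_enum_ord.
have up : uniq p by rewrite sort_uniq enum_uniq.
have memp i : i \in p by rewrite mem_sort mem_enum.
have rankE k : (k < n)%N -> abs_rank x k.+1 = a (nth i0 p k).
  by move=> kn; rewrite /abs_rank sort_map (nth_map i0) ?szp.
have mono k l : (k <= l)%N -> (l < n)%N -> a (nth i0 p l) <= a (nth i0 p k).
  move=> kl ln.
  have /= := @sorted_leq_nth _ (relpre a >=%R) _ _ i0 p _ k l.
  apply => //; rewrite ?inE ?szp ?(leq_ltn_trans kl) //.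
  - by move=> u v w /= h1 h2; apply: le_trans h2 h1.
  - by move=> u /=.
  - by apply: sort_sorted => u v /=; apply: le_total.
have memD i : (i \in drop r p) = (r <= index i p)%N.
  rewrite [RHS]leqNgt -in_take_leq ?szp ?(ltnW rn) //.
  have := up; rewrite -{1}(cat_take_drop r p) cat_uniq => /and3P[_ /hasPn disj _].
  have := memp i; rewrite -{1}(cat_take_drop r p) mem_cat.
  by case: (boolP (i \in drop r p)) => [/disj /= -> //|_]; rewrite orbF => ->.
exists [set i in drop r p], (a (nth i0 p r)); split => //.
- rewrite cardsE; have /card_uniqP -> := drop_uniq r up.
  by rewrite size_drop szp.
- by rewrite normr_ge0.
- move=> i; rewrite inE memD => ri; rewrite -/(a i) -{1}(nth_index i0 (memp i)).
  by apply: mono; rewrite // -[X in (_ < X)%N]szp index_mem.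
- move=> i; rewrite inE memD -ltnNge => /ltnW ir.
  by rewrite -/(a i) -(nth_index i0 (memp i)); apply: mono.
move=> f; rewrite big_add1 /=.
under eq_big_nat => i /andP[_ iltn] do rewrite rankE //.
under [RHS]eq_bigl => i do rewrite inE.
rewrite -big_uniq ?drop_uniq // (big_nth i0) size_drop szp -{1}(add0n r) big_addn.
by apply: eq_bigr => i _; rewrite nth_drop addnC.
Qed.

Definition subset_objective {R : realType} (psi : R -> R -> R) (q : R) {n : nat}
    (S : {set 'I_n}) (x : 'cV[R]_n) : R :=
  \sum_(i in S) psi `|x i ord0| q.

(** Let [D] be the index set of the [n - r] smallest absolute values and [c] the
    threshold above it. Exchanging [S] for [D] trades the indices of [S] outside
    [D], whose terms are at least [psi c q], for equally many indices of [D],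
    whose terms are at most [psi c q]. *)
Lemma rank_objective_le_subset (R : realType) (psi : R -> R -> R) (q : R)
    (n r : nat) (S : {set 'I_n}) (x : 'cV[R]_n) :
  (r < n)%N -> increasing_nonneg (psi^~ q) -> #|S| = (n - r)%N ->
  rank_objective psi r q x <= subset_objective psi q S x.
Proof.
move=> rn incr cS; have [D [c [cD c0 Dle Dge sumE]]] := @smallest_ranks R n r x rn.
rewrite /rank_objective (sumE (psi^~ q)) /subset_objective.
rewrite (big_setID S) [leRHS](big_setID D) /= [in leRHS]finset.setIC lerD2l.
have cDS : #|D :\: S| = #|S :\: D|.
  by rewrite !cardsD cD cS finset.setIC.
apply: (@le_trans _ _ (psi c q *+ #|D :\: S|)).
  rewrite -sumr_const; apply: ler_sum => i /setDP[iD _].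
  by apply: incr; rewrite ?in_itv /= ?andbT ?Dle.
rewrite cDS -sumr_const; apply: ler_sum => i /setDP[_ iD].
by apply: incr; rewrite ?in_itv /= ?andbT ?Dge.
Qed.

Lemma rank_objective_eq_subset (R : realType) (psi : R -> R -> R) (q : R)
    (n r : nat) (x : 'cV[R]_n) :
  (r < n)%N -> exists2 S : {set 'I_n}, #|S| = (n - r)%N &
    rank_objective psi r q x = subset_objective psi q S x.
Proof.
move=> rn; have [D [c [cD _ _ _ sumE]]] := @smallest_ranks R n r x rn.
by exists D => //; rewrite /rank_objective (sumE (psi^~ q)).
Qed.

(** * Rigidity of minimizers *)

(** When [A x = b], this says that the coordinates of [x] in [S] form a vertex of
    the polyhedron obtained by projecting the solutions to the coordinates in
    [S] and keeping the signs of [x] weakly there. The kernel vectors [v] are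
    the directions in which [x] can move both ways within that polyhedron. *)
Definition rigid_on {R : realType} {m n : nat} (A : 'M[R]_(m, n))
    (S : {set 'I_n}) (x : 'cV[R]_n) : Prop :=
  forall v : 'cV[R]_n, A *m v = 0 ->
    (forall i, i \in S -> x i ord0 = 0 -> v i ord0 = 0) ->
    forall i, i \in S -> v i ord0 = 0.

(** While [|b| < |a|], moving [a] by [b] and by [- b] moves [|a|] by [|b|] up and
    down in some order, so a symmetric sum of [g] does not see the signs. *)
Lemma norm_add_sub_pair (R : realType) (g : R -> R) (a b : R) : `|b| < `|a| ->
  g `|a + b| + g `|a - b| = g (`|a| + `|b|) + g (`|a| - `|b|).
Proof.
move=> ba; case: (ger0P a) ba => a0; case: (ger0P b) => b0 ba.
- by rewrite !ger0_norm //; lra.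
- by rewrite !ger0_norm ?opprK 1?addrC //; lra.
- rewrite (ler0_norm (x := a + b)) ?(ler0_norm (x := a - b)); [|lra..].
  by rewrite addrC; congr (g _ + g _); ring.
- rewrite (ler0_norm (x := a + b)) ?(ler0_norm (x := a - b)); [|lra..].
  by congr (g _ + g _); ring.
Qed.

(** If a kernel vector [v] broke rigidity, strict midpoint concavity in the
    coordinates of [S] where [v] is nonzero would make the objectives of
    [x + h v] and [x - h v] sum to less than twice the objective of [x]. *)
Lemma subset_minimizer_rigid (R : realType) (m n : nat) (A : 'M[R]_(m, n))
    (b : 'cV[R]_m) (psi : R -> R -> R) (q : R) (S : {set 'I_n}) (x : 'cV[R]_n) :
  neg_second_derivative (psi^~ q) ->
  A *m x = b ->
  (forall y, A *m y = b ->
    subset_objective psi q S x <= subset_objective psi q S y) ->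
  rigid_on A S x.
Proof.
move=> psi2 Ax xmin v Av vS j jS; apply/eqP/negPn/negP => vj.
(* The step [h] keeps every nonzero entry of [x] from changing its sign. *)
have [h h0 hP] : exists2 h : R, 0 < h & forall i, x i ord0 != 0 ->
    h * `|v i ord0| < `|x i ord0|.
  apply: finite_uniform_pos => [i c d dc h xi|i].
    by apply: le_lt_trans (h xi); apply: ler_wpM2r.
  have [->|xi] := eqVneq (x i ord0) 0; first by exists 1.
  exists (`|x i ord0| / (1 + `|v i ord0|)).
    by rewrite divr_gt0 ?normr_gt0 // ltr_pwDl.
  move=> _; rewrite mulrAC ltr_pdivrMr ?ltr_pwDl //.
  by rewrite ltr_pM2l ?normr_gt0 // ltrDr.
have le2 : subset_objective psi q S x + subset_objective psi q S x <=
   subset_objective psi q S (x + h *: v) + subset_objective psi q S (x - h *: v).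
  apply: lerD; apply: xmin.
    by rewrite mulmxDr -scalemxAr Av scaler0 addr0.
  by rewrite mulmxBr -scalemxAr Av scaler0 subr0.
have term i : x i ord0 != 0 -> v i ord0 != 0 ->
    psi `|(x + h *: v) i ord0| q + psi `|(x - h *: v) i ord0| q <
    psi `|x i ord0| q + psi `|x i ord0| q.
  move=> xi vi; rewrite !mxE (@norm_add_sub_pair R (psi^~ q)) ?normrM
    ?(gtr0_norm h0) ?hP //.
  apply: (@neg_second_derivative_midpoint R (psi^~ q) _ _ psi2); rewrite ?hP //.
  by rewrite mulr_gt0 ?normr_gt0.
have xj : x j ord0 != 0 by apply: contraNneq vj => /(vS j jS) ->.
have term_le i : i \in S ->
    psi `|(x + h *: v) i ord0| q + psi `|(x - h *: v) i ord0| q <=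
    psi `|x i ord0| q + psi `|x i ord0| q.
  move=> iS; have [vi|vi] := eqVneq (v i ord0) 0.
    by rewrite !mxE vi mulr0 addr0 subr0.
  by apply/ltW/term => //; apply: contraNneq vi => /(vS i iS) ->.
suff lt2 :
    subset_objective psi q S (x + h *: v) + subset_objective psi q S (x - h *: v)
    < subset_objective psi q S x + subset_objective psi q S x.
  by have := le_lt_trans le2 lt2; rewrite ltxx.
rewrite /subset_objective -!big_split /= (bigD1 j) //= [ltRHS](bigD1 j) //=.
apply: ltr_leD; first exact: term.
by apply: ler_sum => i /andP[iS _]; apply: term_le.
Qed.

(** Two solutions that are rigid on [S] with the same support in [S] agree on
    [S], so for each of the finitely many choices of [S], of the support in [S]
    and of an index [i] the entry at [i] takes a single value. *)
Lemma rigid_entries_bounded_below (R : realType) (m n : nat) (A : 'M[R]_(m, n))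
    (b : 'cV[R]_m) :
  exists2 c : R, 0 < c & forall (S : {set 'I_n}) (x : 'cV[R]_n),
    A *m x = b -> rigid_on A S x ->
    forall i, i \in S -> x i ord0 != 0 -> c <= `|x i ord0|.
Proof.
pose T (S : {set 'I_n}) (x : 'cV[R]_n) := [set i in S | x i ord0 != 0].
have [|k|c c0 cP] := @finite_uniform_pos R ({set 'I_n} * {set 'I_n} * 'I_n)%type
  (fun k c => forall x : 'cV[R]_n, A *m x = b -> rigid_on A k.1.1 x ->
     T k.1.1 x = k.1.2 -> k.2 \in T k.1.1 x -> c <= `|x k.2 ord0|).
- by move=> k c d dc h x *; apply: le_trans dc (h x _ _ _ _).
- case: k => [[S U] i] /=.
  have [[x0 [Ax0 rig0 Tx0 iT0]]|none] := pselect (exists x0 : 'cV[R]_n,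
     [/\ A *m x0 = b, rigid_on A S x0, T S x0 = U & i \in T S x0]); last first.
    by exists 1 => // x Ax rig Tx iT; case: none; exists x.
  exists `|x0 i ord0|; first by move: iT0; rewrite normr_gt0 inE => /andP[].
  move=> x Ax rig Tx iT.
  have /eqP : (x - x0) i ord0 = 0.
    apply: rig0; first by rewrite mulmxBr Ax Ax0 subrr.
      move=> j jS x0j; rewrite !mxE x0j subr0; apply/eqP/negPn/negP => xj.
      have : j \in T S x by rewrite inE jS.
      by rewrite Tx -Tx0 inE x0j eqxx andbF.
    by move: iT; rewrite inE => /andP[].
  by rewrite !mxE subr_eq0 => /eqP ->.
exists c => // S x Ax rig i iS xi.
by apply: (cP (S, T S x, i)) => //; rewrite inE iS.
Qed.

(** * Comparison with a sparsest solution *)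

Lemma subset_objective_support (R : realType) (psi : R -> R -> R) (q : R)
    (n : nat) (S : {set 'I_n}) (x : 'cV[R]_n) : psi 0 q = 0 ->
  subset_objective psi q S x =
    \sum_(i in [set i in S | x i ord0 != 0]) psi `|x i ord0| q.
Proof.
move=> psi0; rewrite /subset_objective (bigID (fun i => x i ord0 != 0)) /=.
rewrite [X in _ + X]big1 ?addr0 => [|i /andP[_ /negPn/eqP ->]];
  last by rewrite normr0.
by apply: eq_bigl => i; rewrite inE.
Qed.

(** Only [r] indices lie outside [S], so at least [norm0 x - r] of the nonzero
    entries of [x] lie in [S]. *)
Lemma subset_objective_ge (R : realType) (psi : R -> R -> R) (q c : R)
    (n r : nat) (S : {set 'I_n}) (x : 'cV[R]_n) :
  0 < c -> increasing_nonneg (psi^~ q) -> psi 0 q = 0 ->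
  #|S| = (n - r)%N -> (r <= n)%N ->
  (forall i, i \in S -> x i ord0 != 0 -> c <= `|x i ord0|) ->
  psi c q *+ (norm0 x - r) <= subset_objective psi q S x.
Proof.
move=> c0 incr psi0 cS rn cx; rewrite subset_objective_support //.
set T := [set i in S | x i ord0 != 0].
have psi_c0 : 0 <= psi c q.
  by rewrite -psi0; apply: incr; rewrite ?in_itv /= ?andbT ?lexx // ltW.
have cT : (norm0 x - r <= #|T|)%N.
  have : (norm0 x <= #|T :|: ~: S|)%N.
    apply/subset_leq_card/fintype.subsetP => i; rewrite !inE => ->.
    by rewrite andbT orbN.
  have := cardsUI T (~: S); have := cardsC S; rewrite card_ord cS; lia.
apply: (@le_trans _ _ (psi c q *+ #|T|)); first exact: ler_wpMn2l.
rewrite -sumr_const; apply: ler_sum => i; rewrite inE => /andP[iS xi].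
by apply: incr; rewrite ?in_itv /= ?andbT ?(ltW c0) ?cx.
Qed.

(** Leaving out [r] indices taken from the support of [x] gives a set of size
    [n - r] on which only [norm0 x - r] entries are nonzero. *)
Lemma rank_objective_le (R : realType) (psi : R -> R -> R) (q M : R)
    (n r : nat) (x : 'cV[R]_n) :
  increasing_nonneg (psi^~ q) -> psi 0 q = 0 ->
  (r < n)%N -> (r <= norm0 x)%N -> (forall i, `|x i ord0| <= M) ->
  rank_objective psi r q x <= psi M q *+ (norm0 x - r).
Proof.
move=> incr psi0 rn rx xM.
have M0 : 0 <= M := le_trans (normr_ge0 _) (xM (Ordinal rn)).
pose supp := [set i | x i ord0 != 0].
have csupp : #|supp| = norm0 x by rewrite cardsE.
have [S Ssupp cS] : exists2 S : {set 'I_n}, S \subset supp & #|S| = r.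
  by apply: exists_subset_card; rewrite csupp.
have cSC : #|~: S| = (n - r)%N by have := cardsC S; rewrite card_ord cS; lia.
apply: le_trans (@rank_objective_le_subset R psi q n r _ x rn incr cSC) _.
rewrite subset_objective_support // -csupp -cS -cardsDS // -sumr_const.
have -> : [set i in ~: S | x i ord0 != 0] = supp :\: S.
  by apply/finset.setP => i; rewrite !inE.
apply: ler_sum => i _.
by apply: incr; rewrite ?in_itv /= ?andbT ?xM.
Qed.

Lemma positive_below_ereal (R : realType) (alpha : \bar R) : (0 < alpha)%E ->
  exists2 e : R, 0 < e & (e%:E < alpha)%E.
Proof.
case: alpha => [a| |] //; last by exists 1; rewrite ?ltry.
by rewrite lte_fin => a0; exists (a / 2); rewrite ?lte_fin; lra.
Qed.

(** The two sides tend to [k] and to [k + 1]. *)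
Lemma near0_gap (R : realType) (g h : R -> R) (k : nat) :
  (g q @[q --> 0^'+] --> (1 : R))%classic ->
  (h q @[q --> 0^'+] --> (1 : R))%classic ->
  exists2 e : R, 0 < e & forall q, 0 < q -> q < e -> h q *+ k < g q *+ k.+1.
Proof.
move=> g1 h1.
have gap : (g q *+ k.+1 - h q *+ k @[q --> 0^'+] -->
    (1 *+ k.+1 - 1 *+ k : R))%classic.
  by apply: cvgB; apply: cvgMn.
have := cvgr_gt _ gap 0; rewrite mulrS addrK => /(_ _ ltr01) [e /= e0 he].
exists e => // q q0 qe; rewrite -subr_gt0; apply: he => //=.
by rewrite sub0r normrN gtr0_norm.
Qed.

Local Open Scope classical_set_scope.
Local Open Scope ring_scope.

Theorem theorem3p3 (R : realType) (m n : nat) (m_gt0 : (0 < m)%N)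
    (n_gt0 : (0 < n)%N) (A : 'M[R]_(m, n)) (b : 'cV[R]_m)
    (feasible : exists x : 'cV[R]_n, A *m x = b)
    (K : nat) (K_min : is_min (@norm0 R n @` solutions A b) K)
    (alpha : \bar R) (alpha_gt0 : (0 < alpha)%E)
    (psi : R -> R -> R)
    (psi_ge0 : forall t q : R, 0 <= t -> 0 < q -> (q%:E < alpha)%E ->
      0 <= psi t q)
    (psi_lsc : forall q : R, 0 < q -> (q%:E < alpha)%E ->
      lsc_nonneg (fun t => psi t q))
    (psi_incr : forall q : R, 0 < q -> (q%:E < alpha)%E ->
      increasing_nonneg (fun t => psi t q))
    (psi_deriv2 : forall q : R, 0 < q -> (q%:E < alpha)%E ->
      neg_second_derivative (fun t => psi t q))
    (psi_at0 : forall q : R, 0 < q -> (q%:E < alpha)%E -> psi 0 q = 0)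
    (psi_lim : forall t : R, 0 < t -> psi t q @[q --> 0^'+] --> (1 : R))
    (r : nat) (r_le : (r <= minn K (n - 1))%N) :
  exists epsilon : R, [/\ 0 < epsilon, (epsilon%:E < alpha)%E &
    forall q : R, 0 < q -> q < epsilon ->
    forall x : 'cV[R]_n,
      global_minimizer (rank_objective psi r q (n:=n)) (solutions A b) x ->
      global_minimizer (@norm0 R n) (solutions A b) x].
Proof.
have rn : (r < n)%N by lia.
have [[xs Axs Kxs] Kmin] := K_min.
have rK : (r <= norm0 xs)%N by rewrite Kxs; lia.
have [c c0 cP] := @rigid_entries_bounded_below R m n A b.
pose M : R := 1 + \sum_i `|xs i ord0|.
have xsM i : `|xs i ord0| <= M.
  by rewrite /M (bigD1 i) //= addrCA lerDl addr_ge0 // sumr_ge0 // => j _.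
have M0 : 0 < M by rewrite ltr_pwDl // sumr_ge0.
have [e1 e10 e1a] := @positive_below_ereal R alpha alpha_gt0.
have [e2 e20 gap] := @near0_gap R _ _ (K - r) (psi_lim c c0) (psi_lim M M0).
exists (Num.min e1 e2); split.
- by rewrite lt_min e10.
- by apply: le_lt_trans e1a; rewrite lee_fin ge_min lexx.
move=> q q0; rewrite lt_min => /andP[qe1 qe2] x [Ax xmin].
have qa : (q%:E < alpha)%E by apply: lt_trans e1a; rewrite lte_fin.
have incr := psi_incr q q0 qa; have psi0 := psi_at0 q q0 qa.
split=> // y Ay.
have Ky : (K <= norm0 y)%N by apply: Kmin; exists y.
apply: leq_trans Ky; rewrite leqNgt; apply/negP => Kx.
have [S cS xS] := @rank_objective_eq_subset R psi q n r x rn.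
have rig : rigid_on A S x.
  apply: (@subset_minimizer_rigid R m n A b psi q) => //; first exact: psi_deriv2.
  move=> z Az; rewrite -xS; apply: le_trans (xmin z Az) _.
  exact: rank_objective_le_subset.
have lower := @subset_objective_ge R psi q c n r S x c0 incr psi0 cS (ltnW rn)
  (cP S x Ax rig).
have upper := @rank_objective_le R psi q M n r xs incr psi0 rn rK xsM.
have psi_c0 : 0 <= psi c q by apply: psi_ge0 => //; apply: ltW.
have : psi c q *+ (K - r).+1 <= psi M q *+ (K - r).
  rewrite -[in leRHS]Kxs; apply: le_trans upper.
  apply: le_trans (xmin _ Axs); rewrite xS; apply: le_trans lower.
  by apply: ler_wpMn2l => //; rewrite -subSn ?leq_sub2r // -Kxs.
by rewrite leNgt gap.
Qed.
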